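(* Let $\varphi$ be a $\mathbb{Z}^d$-valuation, let $v_1,\dots,v_r\in\mathbb{Z}^d$ be linearly independent and let $I\subseteq[r]$. Then \[\sum_{n\ge0}\varphi\big(n\,\widetilde\lozenge(I)\big)t^n=\frac{\sum_{K\subseteq[r]}b_\varphi(K)\,A_{|I\cup K|+1}(r+1,t)}{(1-t)^{r+1}}.\]
   Context: A $\mathbb{Z}^d$-valuation is a map $\varphi$ from lattice polytopes in $\mathbb{R}^d$ (including $\emptyset$) to an abelian group with $\varphi(\emptyset)=0$, $\varphi(P\cup Q)=\varphi(P)+\varphi(Q)-\varphi(P\cap Q)$ whenever $P,Q,P\cup Q,P\cap Q$ are lattice polytopes, and $\varphi(P+x)=\varphi(P)$ for $x\in\mathbb{Z}^d$. It is evaluated on a set obtained from a lattice polytope $P$ by removing facets $F_1,\dots,F_m$ via $\varphi(P\setminus\bigcup_iF_i):=\varphi(P)-\sum_{\emptyset\ne T\subseteq[m]}(-1)^{|T|-1}\varphi(\bigcap_{i\in T}F_i)$, and on relative interiors via $\varphi(\operatorname{relint}P)=\sum_F(-1)^{\dim P-\dim F}\varphi(F)$ (over nonempty faces $F$). For $n\ge0$, $n\,\widetilde\lozenge(I)$ is the parallelepiped $\{\sum_{i=1}^r\lambda_iv_i:0\le\lambda_i\le n\}$ with the facets $\{\lambda_i=n\}$, $i\in I$, removed (so $\widetilde\lozenge(I)=\{\sum\lambda_iv_i:0\le\lambda_i<1\ (i\in I),\ 0\le\lambda_i\le1\ (i\notin I)\}$). For $K\subseteq[r]$, $b_\varphi(K)=\varphi(\operatorname{relint}\{\sum_{i\in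 K}\lambda_iv_i:0\le\lambda_i\le1\})$, with $b_\varphi(\emptyset)=\varphi(\{0\})$. For $\sigma\in S_m$, $\operatorname{des}(\sigma)=|\{i\in[m-1]:\sigma_i>\sigma_{i+1}\}|$, and $A_j(m,t)=\sum_{\sigma\in S_m,\ \sigma_m=m+1-j}t^{\operatorname{des}(\sigma)}$. *)

(* Defs.v *)
From HB Require Import structures.
From mathcomp Require Import all_boot all_order all_algebra all_fingroup.
From mathcomp Require Import all_classical all_reals.

Set Implicit Arguments.
Unset Strict Implicit.
Unset Printing Implicit Defensive.

Import Order.TTheory GRing.Theory Num.Theory.

Local Open Scope classical_set_scope.
Local Open Scope ring_scope.

Section Polytopes.
Variables (R : realType) (d : nat).
Implicit Types (P Q F : set 'rV[R]_d).

Definition lattice_point (x : 'rV[R]_d) : Prop :=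
  forall j, x ord0 j \is a Num.int.

Definition conv_hull (s : seq 'rV[R]_d) : set 'rV[R]_d :=
  [set x | exists w : 'I_(size s) -> R,
    [/\ forall i, 0 <= w i, \sum_i w i = 1 & x = \sum_i w i *: s`_i]].

(* The empty list of vertices makes set0 a lattice polytope. *)
Definition lattice_polytope P : Prop :=
  exists s : seq 'rV[R]_d,
    (forall x, x \in s -> lattice_point x) /\ P = conv_hull s.

(* The dimension of the affine hull of P, i.e. of the span of the differences
   x - y with x, y in P; it is 0 (not -1) for P = set0. *)
Definition pdim P : nat :=
  \max_(k < d.+1 | `[< exists x y : 'I_k -> 'rV[R]_d,
      [/\ forall i, P (x i), forall i, P (y i)
        & row_free (\matrix_(i < k) (x i - y i))] >]) k.

Definition dotv (a x : 'rV[R]_d) : R := \sum_j a ord0 j * x ord0 j.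

(* A nonempty face is the set of maximizers on P of a linear functional;
   the zero functional gives P itself. *)
Definition nonempty_faces P : set (set 'rV[R]_d) :=
  [set F | F !=set0 /\ exists a : 'rV[R]_d,
    F = [set x | P x /\ forall y, P y -> dotv a y <= dotv a x]].

Variable G : zmodType.

(* A valuation is represented by a total function on sets, whose values
   outside lattice polytopes are unconstrained. *)
Definition Zd_valuation (phi : set 'rV[R]_d -> G) : Prop :=
  [/\ phi set0 = 0,
      forall P Q, lattice_polytope P -> lattice_polytope Q ->
        lattice_polytope (P `|` Q) -> lattice_polytope (P `&` Q) ->
        phi (P `|` Q) = phi P + phi Q - phi (P `&` Q)
    & forall P x, lattice_polytope P -> lattice_point x ->
        phi [set y + x | y in P] = phi P].

Variable phi : set 'rV[R]_d -> G.

(* The value of phi on P minus the union of the F i, i in I. *)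
Definition val_remove (m : finType) P (F : m -> set 'rV[R]_d) (I : {set m}) : G :=
  phi P - \sum_(T : {set m} | (T != finset.set0) && (T \subset I))
            phi (\bigcap_(i in [set` T]) F i) *~ (-1) ^+ #|T|.-1.

(* The sum is over a finite set when P is a polytope. *)
Definition val_relint P : G :=
  \sum_(F \in nonempty_faces P) phi F *~ (-1) ^+ (pdim P - pdim F).

Variables (r : nat) (v : 'I_r -> 'rV[R]_d).

Definition parallelepiped (K : {set 'I_r}) (c : R) : set 'rV[R]_d :=
  [set x | exists l : 'I_r -> R,
    (forall i, i \in K -> 0 <= l i <= c) /\ x = \sum_(i in K) l i *: v i].

Definition upper_facet (c : R) (i : 'I_r) : set 'rV[R]_d :=
  [set x | exists l : 'I_r -> R,
    [/\ forall k, 0 <= l k <= c, l i = c & x = \sum_k l k *: v k]].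

Definition val_halfopen (I : {set 'I_r}) (n : nat) : G :=
  val_remove (parallelepiped [set: 'I_r] n%:R) (upper_facet n%:R) I.

Definition bval (K : {set 'I_r}) : G := val_relint (parallelepiped K 1).

End Polytopes.

Definition des (m : nat) (s : 'S_m) : nat :=
  #|[set p : 'I_m * 'I_m | (val p.2 == p.1.+1) && (s p.2 < s p.1)%N]%SET|.

(* Permutations act on {0, ..., m-1}: the condition reads
   sigma_m = m + 1 - j for the 1-based word of s. *)
Definition eulerA (j m : nat) : {poly int} :=
  \sum_(s : 'S_m |
        [exists i : 'I_m, (i.+1 == m) && ((s i).+1 == m.+1 - j)%N])
    'X^(des s).

(* The coefficients of 1/q in Z[[t]] when q(0) = 1, read off from
   1/q = \sum_k (1 - q)^k; see ps_invpP. *)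
Definition ps_invp (q : {poly int}) (n : nat) : int :=
  \sum_(k < n.+1) ((1 - q) ^+ k)`_n.

(* Power series with coefficients in an abelian group G are sequences, on which
   Z[[t]] acts by convolution; this is a/q in G[[t]]. *)
Definition ps_divp (G : zmodType) (a : nat -> G) (q : {poly int}) (n : nat) : G :=
  \sum_(k < n.+1) a (n - k)%N *~ ps_invp q k.

Lemma coef_exp_small (p : {poly int}) k n :
  p`_0 = 0 -> (n < k)%N -> (p ^+ k)`_n = 0.
Proof.
move=> p0; elim: k n => // k IHk n ltnk.
rewrite exprS coefM big1 // => -[[|i] lti] _ /=; first by rewrite p0 mul0r.
by rewrite IHk ?mulr0 //; move: lti ltnk; case: n => // n; rewrite !ltnS => _ h;
  rewrite subSS (leq_ltn_trans (leq_subr _ _)).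
Qed.

Lemma ps_invpP (q : {poly int}) n :
  q`_0 = 1 -> \sum_(i < n.+1) q`_i * ps_invp q (n - i)%N = (n == 0)%:R.
Proof.
move=> q0; have p0 : (1 - q)`_0 = 0 by rewrite coefB coef1 q0 subrr.
have invE m : (m <= n)%N -> ps_invp q m = (\sum_(k < n.+1) (1 - q) ^+ k)`_m.
  move=> lemn; rewrite coef_sum /ps_invp.
  rewrite (big_ord_widen n.+1 (fun k => ((1 - q) ^+ k)`_m)) //.
  rewrite big_mkcond; apply: eq_bigr => k _; case: ltnP => // ltmk.
  by rewrite coef_exp_small.
under eq_bigr => i _ do rewrite invE ?leq_subr //.
rewrite -coefM; set p := 1 - q; have -> : q = 1 - p by rewrite opprB addrC subrK.
by rewrite -opprB mulNr -subrX1 opprB coefB coef1 coef_exp_small // subr0.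
Qed.

(* Main.v *)
Require Import Defs.
From HB Require Import structures.
From mathcomp Require Import all_boot all_order all_algebra all_fingroup.
From mathcomp Require Import all_classical all_reals.
From mathcomp Require Import zify ring lra.

Import Order.TTheory GRing.Theory Num.Theory.
Local Open Scope classical_set_scope.
Local Open Scope ring_scope.

(** Write [g m] for the value of [phi] on the box
    [{\sum_i l_i v_i : 0 <= l_i <= m_i}].  Cutting the box at an integral level
    of one coordinate and translating shows that [g] is affine in each [m_i]
    separately, so [g] is determined by its values on 0/1 vectors.  Expanding
    both the half-open parallelepiped and the relative interiors (through their
    faces) in these values, and comparing coordinate by coordinate, gives
      [phi (n <>(I)) = \sum_K b(K) n^|I u K| (n+1)^(r-|I u K|)].
    It remains to see that
      [(1-t)^(m+1) \sum_n n^(m-a) (n+1)^a t^n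
         = \sum_(s in S_(m+1), s_last = a) t^(des s) =: P_(m,a)]
    (letters counted from 0),
    which follows by induction on [m]: deleting the last letter of [s] gives the
    recurrence
    [P_(m+1,a) = \sum_(b<a) P_(m,b) + t \sum_(b>=a) P_(m,b)], and on the
    left the same recurrence, up to the factor [1-t], is a telescoping sum. *)

(** * Descents and the last letter of a permutation *)

Definition eulerian_last {m : nat} (a : 'I_m.+1) : {poly int} :=
  \sum_(s : 'S_m.+1 | s ord_max == a) 'X^(des s).

Lemma desE (m : nat) (s : 'S_m) :
  des s = (\sum_(i < m) \sum_(j < m) (val j == i.+1) && (s j < s i))%N.
Proof.
rewrite /des cardsE -sum1_card big_mkcond /=.
rewrite (pair_bigA _ (fun i j : 'I_m =>
  nat_of_bool ((val j == i.+1) && (s j < s i)%N))) /=.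
by apply: eq_bigr => p _; rewrite -topredE.
Qed.

(** [lift_perm ord_max a s] appends the letter [a] to [s] and raises the letters [>= a] by one.
    Raising preserves order, so the only possible new descent is at the last two positions, where it
    occurs exactly when [a <= s ord_max]. *)
Lemma des_lift_perm_max (m : nat) (a : 'I_m.+2) (s : 'S_m.+1) :
  des (lift_perm ord_max a s) = ((a <= s ord_max) + des s)%N.
Proof.
have wE (i : 'I_m.+1) : widen_ord (leqnSn m.+1) i = lift ord_max i.
  by apply: val_inj; rewrite /= /bump leqNgt ltn_ord.
have ltE (i j : 'I_m.+1) : (lift a i < lift a j)%N = (i < j)%N.
  by rewrite /= /bump; case: (leqP a i); case: (leqP a j); lia.
rewrite !desE big_ord_recr /= [X in (_ + X)%N]big1 ?addn0; last first.
  by move=> j _; rewrite (ltn_eqF (ltn_ord j)).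
under eq_bigr => i _ do rewrite big_ord_recr /=.
rewrite big_split /= addnC; congr (_ + _)%N; last first.
  apply: eq_bigr => i _; apply: eq_bigr => j _.
  by rewrite !wE !lift_perm_lift ltE.
rewrite big_ord_recr /= big1 ?add0n => [|i _]; last first.
  by rewrite eqSS gtn_eqF ?ltn_ord.
rewrite eqxx wE lift_perm_id lift_perm_lift /= /bump.
by case: (leqP a (s ord_max)); lia.
Qed.

Lemma eulerian_lastS (m : nat) (a : 'I_m.+2) :
  eulerian_last a =
  \sum_(b < m.+1) 'X^(a <= b)%N * eulerian_last b.
Proof.
rewrite /eulerian_last (reindex (lift_perm ord_max a)); last first.
  (* The inverse deletes position [i] and closes the gap left among the letters. Keeping [i] general
     lets the same construction on [s^-1] supply injectivity. *)
  pose ulsf i (s : 'S_m.+2) k := odflt k (unlift (s i) (s (lift i k))).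
  have ulsfK i (s : 'S_m.+2) k : lift (s i) (ulsf i s k) = s (lift i k).
    rewrite /ulsf; have:= neq_lift i k.
    by rewrite -(can_eq (permK s)) => /unlift_some[] ? ? ->.
  have inj_ulsf : injective (ulsf ord_max _).
    move=> s; apply: can_inj (ulsf (s ord_max) s^-1%g) _ => k'.
    by rewrite {1}/ulsf ulsfK !permK liftK.
  exists (fun s => perm (inj_ulsf s)) => [s _ | s].
    by apply/permP=> k'; rewrite permE /ulsf lift_perm_lift lift_perm_id liftK.
  move/(s _ =P _) => si0; apply/permP=> k.
  case: (unliftP ord_max k) => [k'|] ->; rewrite ?lift_perm_id //.
  by rewrite lift_perm_lift -si0 permE ulsfK.
under eq_bigl => s do rewrite lift_perm_id eqxx.
rewrite (partition_big (fun s : 'S_m.+1 => s ord_max) xpredT) //=.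
apply: eq_bigr => b _; rewrite big_distrr /=.
by apply: eq_bigr => s /eqP sb; rewrite des_lift_perm_max sb exprD.
Qed.

(** With letters counted from 0, the condition sigma_(m+1) = (m+2) - (j+1) says that the last letter
    is m - j. *)
Lemma eulerAE (m j : nat) (a : 'I_m.+1) : (a + j = m)%N ->
  eulerA j.+1 m.+1 = eulerian_last a.
Proof.
move=> ajm; apply: eq_bigl => s; apply/existsP/idP => [[i]|/eqP sa].
  case/andP=> /eqP [im] /eqP si; have -> : ord_max = i by apply: val_inj.
  by apply/eqP/val_inj => /=; move: si; lia.
by exists ord_max; rewrite eqxx sa /=; lia.
Qed.

(** * Truncated power series *)

(** Congruence modulo ['X^N]: identities of power series are handled through polynomial
    truncations. *)
Definition eqXn (N : nat) (p q : {poly int}) : Prop :=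
  forall n, (n < N)%N -> p`_n = q`_n.

Lemma eqXn_mul {N : nat} {p p' q q' : {poly int}} :
  eqXn N p p' -> eqXn N q q' -> eqXn N (p * q) (p' * q').
Proof.
move=> pp' qq' n ltnN; rewrite !coefM; apply: eq_bigr => i _.
by rewrite pp' ?qq' // (leq_ltn_trans _ ltnN) ?leq_subr // -ltnS.
Qed.

Lemma eqXn_sum (N : nat) (T : finType) (p q : T -> {poly int}) :
  (forall i, eqXn N (p i) (q i)) -> eqXn N (\sum_i p i) (\sum_i q i).
Proof. by move=> pq n ltnN; rewrite !coef_sum; apply: eq_bigr => i _; apply: pq. Qed.

Definition powser (N m a : nat) : {poly int} :=
  \poly_(n < N) (n%:R ^+ (m - a) * n.+1%:R ^+ a).

(** Insert (n+1)^(m+1) between the two products. Each half is then a power of n+1 times a difference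
    of equal powers of consecutive integers; factoring these differences gives the terms [b < a] and
    [b >= a] respectively. *)
Lemma telescope_powers (m a n : nat) : (a <= m.+1)%N ->
  n.+1%:R ^+ (m.+1 - a) * n.+2%:R ^+ a - n%:R ^+ (m.+1 - a) * n.+1%:R ^+ a =
  \sum_(b < m.+1) (if (a <= b)%N then n%:R ^+ (m - b) * n.+1%:R ^+ b
                   else n.+1%:R ^+ (m - b) * n.+2%:R ^+ b) :> int.
Proof.
move=> leam.
have key k (x : int) : (x + 1) ^+ k - x ^+ k = \sum_(b < k) x ^+ (k.-1 - b) * (x + 1) ^+ b.
  rewrite -opprB subrXX opprD addrA subrr add0r mulN1r opprK.
  by apply: eq_bigr.
rewrite -!(big_mkord xpredT (fun b => if (a <= b)%N then n%:R ^+ (m - b) * n.+1%:R ^+ b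
                   else n.+1%:R ^+ (m - b) * n.+2%:R ^+ b)).
rewrite (@big_cat_nat _ _ _ a) //=.
rewrite (eq_big_nat _ _ (F2 := fun b => n.+1%:R ^+ (m.+1 - a) *
  (n.+1%:R ^+ (a.-1 - b) * (n.+1%:R + 1) ^+ b))); last first.
  move=> b /andP[_ ltba]; rewrite leqNgt ltba /= mulrA -exprD natr1.
  by congr (_ ^+ _ * _); lia.
rewrite -mulr_sumr big_mkord -key.
rewrite -[in X in _ = _ + X](addn0 a) addnC big_addn.
rewrite (eq_bigr (fun b => n.+1%:R ^+ a *
  (n%:R ^+ ((m.+1 - a).-1 - b) * (n%:R + 1) ^+ b))); last first.
  move=> b _; rewrite leq_addl natr1 mulrCA -exprD.
  by congr (_ ^+ _ * _ ^+ _); lia.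
rewrite -mulr_sumr big_mkord -key !natr1.
ring.
Qed.

Lemma powserS (N m a : nat) : (a <= m.+1)%N ->
  eqXn N ((1 - 'X) * powser N m.+1 a)
         (\sum_(b < m.+1) 'X^(a <= b)%N * powser N m b).
Proof.
move=> leam n ltnN; rewrite mulrBl mul1r coefB coefXM coef_poly ltnN coef_sum.
case: n ltnN => [|n] ltnN /=.
  rewrite subr0 expr1n mulr1.
  (* In degree 0 only [b = m] can contribute, as 0^(m-b) vanishes otherwise, and it does so only
     when a = m+1. This matches 0^(m+1-a) on the left, with 0^0 = 1. *)
  have cE (b : 'I_m.+1) : ('X^(a <= b)%N * powser N m b)`_0 =
      if (b : nat) == m then ((m < a)%N%:R : int) else 0.
    rewrite coefXnM; case: (leqP a b) => [leab|ltba] /=.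
      by case: eqP => // eqbm; rewrite ltnNge -eqbm leab.
    rewrite coef_poly ltnN expr1n mulr1 expr0n /= subn_eq0.
    case: eqP ltba => [-> ->|ne _]; first by rewrite leqnn.
    have := ltn_ord b; rewrite ltnS leq_eqVlt => /predU1P[//|].
    by rewrite ltnNge => /negbTE ->.
  under eq_bigr => b _ do rewrite cE.
  rewrite big_ord_recr /= eqxx big1 ?add0r => [|i _]; last first.
    by rewrite (ltn_eqF (ltn_ord i)).
  by rewrite expr0n subn_eq0.
rewrite coef_poly (ltnW ltnN) telescope_powers //.
apply: eq_bigr => b _; rewrite coefXnM; case: (leqP a b) => /= _.
  by rewrite subn1 /= coef_poly (ltnW ltnN).
by rewrite subn0 coef_poly ltnN.
Qed.

(** One factor [1 - 'X] is spent on [powserS], the others on the induction hypothesis; the case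
    [m = 0] is the geometric series. *)
Lemma powser_eulerian (N m : nat) (a : 'I_m.+1) :
  eqXn N ((1 - 'X) ^+ m.+1 * powser N m a) (eulerian_last a).
Proof.
elim: m a => [|m IHm] a.
  rewrite ord1 => n ltnN.
  rewrite expr1 mulrBl mul1r coefB coefXM !coef_poly ltnN.
  have -> : @eulerian_last 0 ord0 = 1.
    rewrite /eulerian_last (big_pred1 1%g) => [|s].
      rewrite desE !big_ord1 /= expr0 //.
    rewrite /= [s ord_max]ord1; apply/eqP/eqP => // _.
    by apply/permP => i; rewrite [RHS]ord1 [LHS]ord1.
  rewrite coef1; case: n ltnN => [|n] ltnN /=; first by rewrite !expr0 mulr1 subr0.
  by rewrite (ltnW ltnN) !expr0 mulr1 subrr.
rewrite exprSr -mulrA eulerian_lastS => n ltnN.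
rewrite (eqXn_mul (fun _ _ => erefl) (powserS N m a _)) //; last by rewrite -ltnS.
rewrite mulr_sumr; apply: (eqXn_sum N) ltnN => b n' ltnN.
by rewrite mulrCA (eqXn_mul (fun _ _ => erefl) (IHm b)).
Qed.

Lemma ps_invp_mul (N : nat) (q : {poly int}) : q`_0 = 1 ->
  eqXn N (q * \poly_(n < N) ps_invp q n) 1.
Proof.
move=> q0 n ltnN; rewrite coefM coef1 -(ps_invpP _ q0).
by apply: eq_bigr => i _; rewrite coef_poly (leq_ltn_trans (leq_subr _ _)).
Qed.

(** Multiplying [powser_eulerian] by the truncated inverse [J] of [q] cancels [q] modulo
    ['X^n.+1]. *)
Lemma eulerian_quotient (m n : nat) (a : 'I_m.+1) :
  \sum_(k < n.+1) (eulerian_last a)`_(n - k) * ps_invp ((1 - 'X) ^+ m.+1) k =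
  n%:R ^+ (m - a) * n.+1%:R ^+ a.
Proof.
set q := (1 - 'X) ^+ m.+1.
have q0 : q`_0 = 1.
  by rewrite -horner_coef0 horner_exp !hornerE ?expr1n.
have -> : n%:R ^+ (m - a) * n.+1%:R ^+ a = (powser n.+1 m a)`_n.
  by rewrite coef_poly ltnSn.
pose J := \poly_(k < n.+1) ps_invp q k.
transitivity ((eulerian_last a * J)`_n).
  rewrite mulrC coefM; apply: eq_bigr => k _.
  by rewrite coef_poly ltn_ord mulrC.
rewrite -(eqXn_mul (powser_eulerian n.+1 m a) (fun _ _ => erefl)) //.
rewrite -mulrA mulrCA -[in RHS](mulr1 (powser n.+1 m a)).
exact: (eqXn_mul (fun _ _ => erefl) (ps_invp_mul n.+1 _ q0)).
Qed.

(** * Multiaffine functions *)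

Definition upd {r : nat} {T : Type} (f : 'I_r -> T) (i : 'I_r) (x : T) : 'I_r -> T :=
  fun j => if j == i then x else f j.

Lemma updE {r : nat} {T : Type} (f : 'I_r -> T) (i : 'I_r) : upd f i (f i) = f.
Proof. by apply/funext => j; rewrite /upd; case: eqP => [->|]. Qed.

Definition indic {r : nat} (J : {set 'I_r}) : 'I_r -> nat := fun i => i \in J.

Section Multiaffine.
Variables (r : nat) (G : zmodType) (g : ('I_r -> nat) -> G).
(** Affinity in each coordinate, in the form that cutting a box at level [k] provides. *)
Hypothesis gD : forall m i k, g (upd m i k.+1) =
  g (upd m i k) + g (upd m i 1) - g (upd m i 0).

Lemma multiaffine_coord (m : 'I_r -> nat) (i : 'I_r) (k : nat) :
  g (upd m i k) =
  g (upd m i 1) *~ k%:R + g (upd m i 0) *~ (1 - k%:R).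
Proof.
elim: k => [|k IHk]; first by rewrite mulr0z add0r subr0 mulr1z.
rewrite gD IHk -natr1 opprD addrA (mulrzDr _ k%:R 1) (mulrzDr _ (1 - k%:R) (-1)).
by rewrite mulr1z mulrN1z addrA; congr (_ - _); rewrite addrAC.
Qed.

(** Multilinear interpolation from the vertices of the cube. Induction on the number of coordinates
    above 1: such a coordinate is replaced by 1 and by 0 through [multiaffine_coord]. *)
Lemma multiaffine_expand (m : 'I_r -> nat) :
  g m = \sum_(J : {set 'I_r}) g (indic J) *~
          \prod_i (if i \in J then (m i)%:R else 1 - (m i)%:R).
Proof.
have [n] := ubnP #|[set i | (1 < m i)%N]%SET|; elim: n m => // n IHn m.
case: (set_0Vmem [set i | (1 < m i)%N]%SET) => [m01 _|[i]].
  have le1 i : (m i <= 1)%N.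
    by rewrite leqNgt; apply/negP => h; have := finset.in_set0 i; rewrite -m01 inE h.
  (* On a 0/1 vector the product is a Kronecker delta selecting [J0]. *)
  pose J0 := [set i | m i == 1%N]%SET.
  have mE : m = indic J0.
    by apply/funext => i; rewrite /indic inE; move: (le1 i); case: (m i) => [|[|]].
  rewrite (bigD1 J0) //= [X in _ + X]big1 => [|J neJ].
    rewrite addr0 big1 => [|i _]; first by rewrite -mE.
    by rewrite inE; move: (le1 i); case: (m i) => [|[|]] //= _; rewrite subr0.
  have [i iJ] : exists i, (i \in J) != (i \in J0).
    apply/existsP; rewrite -negb_forall; apply: contra neJ => /forallP h.
    by apply/eqP/setP => i; apply/eqP.
  rewrite (bigD1 i) //= (_ : (if i \in J then _ else _) = 0) ?mul0r ?mulr0z //.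
  move: iJ (le1 i); rewrite inE; case: (i \in J); case: (m i) => [|[|]] //=.
rewrite inE => mi ltn.
have lt0 k : (k <= 1)%N -> (#|[set j | (1 < upd m i k j)%N]%SET| < n)%N.
  move=> lek; rewrite -ltnS; apply: leq_trans ltn; rewrite ltnS; apply: proper_card.
  apply/properP; split.
    apply/fintype.subsetP => j; rewrite !inE /upd; case: eqP => // _ h.
    by have := leq_trans h lek.
  by exists i; rewrite ?inE /upd ?eqxx // -leqNgt.
rewrite -[in LHS](updE m i) multiaffine_coord (IHn _ (lt0 1%N _)) // (IHn _ (lt0 0%N _)) //.
rewrite !mulrz_suml -big_split /=; apply: eq_bigr => J _.
rewrite -!mulrzA -mulrzDr; congr (_ *~ _).
rewrite (bigD1 i) //= [in X in _ + X](bigD1 i) //= [in RHS](bigD1 i) //=.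
set p := \prod_(j | j != i) (if j \in J then (upd m i 1 j)%:R else _).
set p0 := \prod_(j | j != i) (if j \in J then (upd m i 0 j)%:R else _).
set p1 := \prod_(j | j != i) (if j \in J then (m j)%:R else _).
have -> : p = p1 by apply: eq_bigr => j /negbTE ne; rewrite /upd ne.
have -> : p0 = p1 by apply: eq_bigr => j /negbTE ne; rewrite /upd ne.
rewrite /upd eqxx; case: (i \in J); ring.
Qed.

End Multiaffine.

(** * Lattice boxes *)

(** Allows the corners of a box to be indexed by subsets instead of list positions. *)
Lemma conv_hull_fin (R : realType) (d : nat) (T : finType) (u : T -> 'rV[R]_d) :
  conv_hull [seq u t | t : T] =
  [set x | exists w : T -> R,
    [/\ forall t, 0 <= w t, \sum_t w t = 1 & x = \sum_t w t *: u t]].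
Proof.
set s := [seq u t | t : T].
have sz : size s = #|T| by rewrite size_image.
pose f (i : 'I_(size s)) : T := enum_val (cast_ord sz i).
pose f' (t : T) : 'I_(size s) := cast_ord (esym sz) (enum_rank t).
have fK : cancel f f' by move=> i; rewrite /f /f' enum_valK cast_ordK.
have f'K : cancel f' f by move=> t; rewrite /f /f' cast_ordKV enum_rankK.
have sE (i : 'I_(size s)) : s`_i = u (f i) by rewrite -(nth_image 0 u).
apply/seteqP; split => x [w [w0 w1 ->]].
  exists (w \o f'); split => [t||]; first exact: w0.
    by rewrite -w1 (reindex f') //; exists f => ? _.
  rewrite (reindex f'); last by exists f => ? _.
  by apply: eq_bigr => t _; rewrite sE f'K.
exists (w \o f); split => [t||]; first exact: w0.
  by rewrite -w1 (reindex f) //; exists f' => ? _.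
rewrite [LHS](reindex f); last by exists f' => ? _.
by apply: eq_bigr => t _; rewrite sE.
Qed.

Section Boxes.
Variables (R : realType) (d r : nat) (v : 'I_r -> 'rV[R]_d).
Implicit Types (l lo hi c : 'I_r -> R) (a b m : 'I_r -> nat).

Definition lin l : 'rV[R]_d := \sum_i l i *: v i.

Definition box lo hi : set 'rV[R]_d :=
  [set x | exists l, (forall i, lo i <= l i <= hi i) /\ x = lin l].

Definition natbox a b := box (fun i => (a i)%:R) (fun i => (b i)%:R).

Lemma linD l c : lin (fun i => l i + c i) = lin l + lin c.
Proof. by rewrite /lin -big_split; apply: eq_bigr => i _; rewrite scalerDl. Qed.

Lemma linB l c : lin (fun i => l i - c i) = lin l - lin c.
Proof.
by rewrite /lin -sumrB; apply: eq_bigr => i _; rewrite scalerBl.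
Qed.

Lemma box_translate lo hi c :
  [set y + lin c | y in box lo hi] =
  box (fun i => lo i + c i) (fun i => hi i + c i).
Proof.
apply/seteqP; split => [_ [_ [l [hl ->]] <-]|_ [l [hl ->]]].
  by exists (fun i => l i + c i); rewrite linD; split => // i; rewrite !lerD2r.
exists (lin (fun i => l i - c i)); last by rewrite linB subrK.
by exists (fun i => l i - c i); split => // i; rewrite lerBrDr lerBlDr.
Qed.

Hypothesis hvfree : row_free (\matrix_(i < r) v i).

Lemma lin_inj l c : lin l = lin c -> l = c.
Proof.
have linE l' : lin l' = (\row_i l' i) *m \matrix_(i < r) v i.
  by rewrite mulmx_sum_row; apply: eq_bigr => i _; rewrite mxE rowK.
rewrite !linE => /(row_free_inj hvfree)/rowP lc.
by apply/funext => i; have := lc i; rewrite !mxE.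
Qed.

Lemma boxE lo hi l : box lo hi (lin l) <-> forall i, lo i <= l i <= hi i.
Proof. by split=> [[l' [hl' /lin_inj ->]]|hl] //; exists l. Qed.

(** The extreme corners of each box lie in the other one. *)
Lemma box_inj lo hi lo' hi' :
  (forall i, lo i <= hi i) -> (forall i, lo' i <= hi' i) ->
  box lo hi = box lo' hi' -> lo = lo' /\ hi = hi'.
Proof.
move=> h h' e.
have /boxE A : box lo' hi' (lin lo) by rewrite -e; apply/boxE => i; rewrite lexx h.
have /boxE B : box lo' hi' (lin hi) by rewrite -e; apply/boxE => i; rewrite lexx h.
have /boxE C : box lo hi (lin lo') by rewrite e; apply/boxE => i; rewrite lexx h'.
have /boxE D : box lo hi (lin hi') by rewrite e; apply/boxE => i; rewrite lexx h'.
split; apply/funext => i; apply/le_anti.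
  by have /andP[-> _] := A i; have /andP[-> _] := C i.
by have /andP[_ ->] := B i; have /andP[_ ->] := D i.
Qed.

Hypothesis hvZ : forall i, lattice_point (v i).

Lemma lattice_point_lin a : lattice_point (lin (fun i => (a i)%:R)).
Proof.
move=> j; rewrite /lin summxE rpred_sum // => i _.
by rewrite mxE rpredM // ?natr_int //; apply: hvZ.
Qed.

Lemma lattice_polytope_natbox a b : (forall i, (a i <= b i)%N) ->
  lattice_polytope (natbox a b).
Proof.
move=> leab.
pose c (A : {set 'I_r}) i : nat := if i \in A then b i else a i.
pose u (A : {set 'I_r}) := lin (fun i => (c A i)%:R).
exists [seq u A | A : {set 'I_r}]; split.
  by move=> x /mapP[A _ ->]; apply: lattice_point_lin.
rewrite conv_hull_fin; apply/seteqP; split => [_ [l [hl ->]]|_ [w [w0 w1 ->]]].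
  (* Barycentric coordinate along direction [i]. If [a i = b i], division by zero yields 0, which is
     harmless since then [l i = a i]. *)
  pose t i : R := (l i - (a i)%:R) / ((b i)%:R - (a i)%:R).
  have lE i : t i * (b i)%:R + (1 - t i) * (a i)%:R = l i.
    have [eab|neab] := eqVneq (a i) (b i).
      have := hl i; rewrite /t eab subrr invr0 mulr0 mul0r add0r subr0 mul1r.
      by move=> /le_anti.
    rewrite /t; field; rewrite subr_eq0 eqr_nat eq_sym //.
  have t01 i : 0 <= t i <= 1.
    have /andP[al lb] := hl i.
    have [eab|neab] := eqVneq (a i) (b i).
      by rewrite /t eab subrr invr0 mulr0 lexx ler01.
    have ab : 0 < (b i)%:R - (a i)%:R :> R.
      by rewrite subr_gt0 ltr_nat ltn_neqAle neab leab.
    by rewrite /t divr_ge0 ?subr_ge0 ?ler_nat //= ler_pdivrMr // mul1r lerD2r.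
  (* Product weights, as for independent choices of an end in each direction; expanding the product
     of the sums [t i + (1 - t i)] gives total weight 1. *)
  exists (fun A : {set 'I_r} => \prod_i (if i \in A then t i else 1 - t i)); split.
  - move=> A; apply: prodr_ge0 => i _; have /andP[t0 t1] := t01 i.
    by case: ifP => _ //; rewrite subr_ge0.
  - rewrite -(bigA_distr _ _ t (fun i => 1 - t i)) big1 // => i _.
    by rewrite /= addrC subrK.
  - under eq_bigr => A _ do rewrite /u /lin scaler_sumr.
    rewrite exchange_big /=; apply: eq_bigr => i _.
    under eq_bigr => A _ do rewrite scalerA.
    rewrite -scaler_suml; congr (_ *: _).
    (* The mean of the [i]-th corner coordinate is again a product of sums, with the end values
       inserted at index [i] only. *)
    pose F j := t j * (if j == i then (b i)%:R else 1).
    pose F' j := (1 - t j) * (if j == i then (a i)%:R else 1).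
    transitivity (\sum_(A : {set 'I_r}) \prod_j (if j \in A then F j else F' j)).
      rewrite -(bigA_distr _ _ F F') (bigD1 i) //= big1 ?mulr1 /F /F' ?eqxx ?lE //.
      by move=> j /negbTE ->; rewrite !mulr1 /= addrC subrK.
    apply: eq_bigr => A _; rewrite (bigD1 i) //= [in RHS](bigD1 i) //=.
    rewrite /F /F' /c eqxx [RHS]mulrAC; congr (_ * _); first by case: ifP.
    by apply: eq_bigr => j /negbTE ->; rewrite !mulr1.
exists (fun i => \sum_A w A * (c A i)%:R); split => [i|].
  have wE x : x = \sum_A w A * x by rewrite -mulr_suml w1 mul1r.
  rewrite [X in X <= _]wE [X in _ <= _ <= X]wE.
  apply/andP; split; apply: ler_sum => A _; apply: ler_wpM2l => //.
    by rewrite ler_nat /c; case: ifP.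
  by rewrite ler_nat /c; case: ifP.
under eq_bigr => A _ do rewrite /u /lin scaler_sumr.
rewrite exchange_big /=; apply: eq_bigr => i _.
by rewrite scaler_suml; apply: eq_bigr => A _; rewrite scalerA.
Qed.

(** * Values of a valuation on lattice boxes *)

Variables (G : zmodType) (phi : set 'rV[R]_d -> G).
Hypothesis hphi : Zd_valuation phi.

Definition boxval m : G := phi (natbox (fun=> 0%N) m).

Lemma phi_natbox a b : (forall i, (a i <= b i)%N) ->
  phi (natbox a b) = boxval (fun i => b i - a i)%N.
Proof.
case: hphi => _ _ phiT leab; rewrite /boxval.
rewrite -[RHS](phiT _ _ _ (lattice_point_lin a)); last exact: lattice_polytope_natbox.
rewrite box_translate; congr (phi (box _ _)); apply/funext => i.
  by rewrite mulr0n add0r.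
by rewrite -natrD subnK.
Qed.

(** The box of height [k.+1] is the box of height [k] together with the slab between levels [k] and
    [k.+1]. The slab and the common facet are translates of boxes of height 1 and 0. *)
Lemma boxvalD m (i : 'I_r) (k : nat) :
  boxval (upd m i k.+1) =
  boxval (upd m i k) + boxval (upd m i 1) - boxval (upd m i 0).
Proof.
case: hphi => _ phiU _.
pose z : 'I_r -> nat := fun=> 0%N.
have ext x y : (forall j, ((if j == i then x else 0) <= (if j == i then y else m j))%N) ->
    phi (natbox (upd z i x) (upd m i y)) = boxval (upd m i (y - x)%N).
  move=> h; rewrite phi_natbox //; congr boxval; apply/funext => j.
  by rewrite /upd; case: eqP => // _; rewrite subn0.
have -> : boxval (upd m i 1) =
    phi (natbox (upd z i k) (upd m i k.+1)).
  by rewrite ext ?subSnn // => j; case: eqP.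
have -> : boxval (upd m i 0) =
    phi (natbox (upd z i k) (upd m i k)).
  by rewrite ext ?subnn // => j; case: eqP.
(* Linear independence enters here: both memberships concern the same coefficients. *)
have EI : natbox z (upd m i k) `&` natbox (upd z i k) (upd m i k.+1)
        = natbox (upd z i k) (upd m i k).
  apply/seteqP; split => [_ [[l [hl ->]]]|_ [l [hl ->]]].
    move/boxE => hl'; exists l; split => // j.
    by have := hl j; have := hl' j; rewrite /upd; case: eqP => _ //; lra.
  split; exists l; split => // j; have := hl j; rewrite /upd /z; case: eqP => _ //.
    by have := ler0n R k; lra.
  by rewrite -natr1; lra.
have EU : natbox z (upd m i k) `|` natbox (upd z i k) (upd m i k.+1)
        = natbox z (upd m i k.+1).
  apply/seteqP; split => [_ [] [l [hl ->]]|_ [l [hl ->]]].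
  - exists l; split => // j; have := hl j; rewrite /upd /z; case: eqP => _ //.
    by rewrite -natr1; lra.
  - exists l; split => // j; have := hl j; rewrite /upd /z; case: eqP => _ //.
    by have := ler0n R k; lra.
  - have [lk|kl] := leP (l i) k%:R; [left|right]; exists l; split => // j;
    have := hl j; rewrite /upd /z; case: eqP => [->|] //; lra.
rewrite -EI -phiU ?EU ?EI //; apply: lattice_polytope_natbox => j; rewrite /upd //.
- by case: eqP.
- by case: eqP.
Qed.

Definition cubeval (J : {set 'I_r}) : G := boxval (indic J).

Lemma boxval_expand m :
  boxval m = \sum_J cubeval J *~
               \prod_i (if i \in J then (m i)%:R else 1 - (m i)%:R).
Proof. exact: (multiaffine_expand _ _ _ boxvalD). Qed.

(** Inclusion-exclusion factors over coordinates: a direction in [I] contributes its interpolation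
    factor at height [n] minus the one at height 0, any other direction just the factor at [n]. *)
Lemma val_halfopenE (I : {set 'I_r}) (n : nat) :
  val_halfopen phi v I n =
  \sum_J cubeval J *~ \prod_i (if i \in J then n%:R else (i \notin I)%:R - n%:R).
Proof.
pose g (T : {set 'I_r}) := boxval (fun i => if i \in T then 0 else n)%N.
(* The full parallelepiped becomes the term of the empty [T]; a face with the coordinates in [T]
   fixed at [n] is translated to height 0 there. *)
have -> : val_halfopen phi v I n = \sum_(T : {set 'I_r} | T \subset I) g T *~ (-1) ^+ #|T|.
  rewrite /val_halfopen /val_remove [RHS](bigD1 finset.set0) ?finset.sub0set //=.
  rewrite cards0 expr0 mulr1z; congr (_ + _).
    congr phi; apply/seteqP; split => _ [l [hl ->]].
      exists l; split => [i|].
        by rewrite finset.in_set0; apply: hl; rewrite finset.in_setT.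
      by apply: eq_bigl => i; rewrite finset.in_setT.
    exists l; split => [i _|]; first by have := hl i; rewrite finset.in_set0.
    by apply: eq_bigl => i; rewrite finset.in_setT.
  rewrite -sumrN; apply: eq_big => [T|T /andP[T0 TI]]; first by rewrite andbC.
  have -> : \bigcap_(i in [set` T]) upper_facet v n%:R i =
      natbox (fun i => if i \in T then n else 0)%N (fun=> n).
    apply/seteqP; split => [x hx|_ [l [hl ->]] i /= iT].
      have /finset.set0Pn[i0 i0T] := T0.
      have [l [hl _ xE]] := hx _ i0T.
      exists l; split => // i; have := hl i; case: ifP => // iT _.
      have [l' [hl' l'i /esym xE']] := hx _ iT.
      by have := hl i; rewrite -(lin_inj _ _ (etrans xE' xE)) l'i lexx.
    exists l; split => // [k|].
      by have := hl k; case: ifP => // _ /andP[/(le_trans (ler0n _ _)) -> ->].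
    by have := hl i; rewrite iT => /le_anti.
  rewrite phi_natbox => [|i]; last by case: ifP.
  rewrite -mulrNz -[- (-1) ^+ _]mulN1r -exprS prednK ?card_gt0 //.
  congr (boxval _ *~ _); apply/funext => i.
  by case: ifP; rewrite ?subnn ?subn0.
rewrite (eq_bigr (fun T : {set 'I_r} => \sum_J cubeval J *~
  ((-1) ^+ #|T| * \prod_i (if i \in J then (if i \in T then 0 else n)%N%:R
                           else 1 - (if i \in T then 0 else n)%N%:R)))); last first.
  move=> T _; rewrite /g boxval_expand mulrz_suml; apply: eq_bigr => J _.
  by rewrite -mulrzA mulrC.
rewrite exchange_big /=; apply: eq_bigr => J _; rewrite -mulrz_sumr; congr (_ *~ _).
(* [F] is the signed factor for [i] in [T], [F'] the one for [i] outside [T]. [F] vanishes off [I],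
   so only subsets of [I] survive. *)
pose F i : int := if i \in I then - (if i \in J then 0 else 1) else 0.
pose F' i : int := if i \in J then n%:R else 1 - n%:R.
transitivity (\prod_i (F i + F' i)); last first.
  apply: eq_bigr => i _; rewrite /F /F'.
  by case: (i \in I); case: (i \in J) => /=; ring.
rewrite bigA_distr big_mkcond /=; apply: eq_bigr => T _.
case: ifP => [/fintype.subsetP TI|/negbT/fintype.subsetPn[i iT iI]].
  rewrite -prodr_const [X in X * _]big_mkcond /= -big_split /=.
  apply: eq_bigr => i _; rewrite /F /F'.
  case: ifP => [/TI ->|_]; case: ifP => _ //=; ring.
by rewrite (bigD1 i) //= iT /F (negbTE iI) mul0r.
Qed.

(** * Dimension and faces of boxes *)

(** Differences of points lie in the span of the [v i] with [i] in [D], which bounds the dimension;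
    the edges at the corner [lin lo] attain the bound. *)
Lemma pdim_box lo hi : (forall i, lo i <= hi i) ->
  pdim (box lo hi) = #|[set i | lo i < hi i]%SET|.
Proof.
move=> lohi; set D := [set i | lo i < hi i]%SET.
have ltD i : i \in D -> hi i - lo i != 0.
  by rewrite inE subr_eq0 => /gt_eqF ->.
apply/eqP; rewrite eqn_leq; apply/andP; split.
  apply/bigmax_leqP => k /asboolP[x [y [hx hy /eqP xyfree]]].
  have [lx xE] := choice hx; have [ly yE] := choice hy.
  pose A := \matrix_(i < k, p < #|D|) (lx i (enum_val p) - ly i (enum_val p)).
  pose B := \matrix_(p < #|D|) v (enum_val p).
  have -> : k = \rank (A *m B) :> nat.
    rewrite -[LHS]xyfree; congr (\rank _); apply/row_matrixP => i.
    rewrite rowK row_mul mulmx_sum_row.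
    have [hlx ->] := xE i; have [hly ->] := yE i; rewrite -linB /lin.
    rewrite (bigID (fun j => j \in D)) /= [X in _ + X]big1 ?addr0 => [|j].
      rewrite big_enum_val; apply: eq_bigr => p _.
      by rewrite !mxE rowK.
    rewrite inE -leNgt => hl.
    suff -> : lx i j = ly i j by rewrite subrr scale0r.
    by have := hlx j; have := hly j; have := lohi j; lra.
  exact: leq_trans (mxrankM_maxl _ _) (rank_leq_col _).
(* The maximum in [pdim] stops at [d]; independence gives #|D| <= r <= d. *)
have ltDd : (#|D| < d.+1)%N.
  rewrite ltnS (leq_trans (max_card _)) // card_ord -(eqP hvfree).
  exact: rank_leq_col.
apply: (@leq_bigmax_cond _ _ (fun k : 'I_d.+1 => k : nat) (Ordinal ltDd)).
apply/asboolP.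
exists (fun p => lin (upd lo (enum_val p) (hi (enum_val p)))).
exists (fun=> lin lo); split => /= [p|p|].
- by apply/boxE => i; rewrite /upd; case: eqP => [->|_]; rewrite lohi lexx.
- by apply/boxE => i; rewrite lohi lexx.
have /row_freeP[W VW] := hvfree.
apply/row_freeP.
(* A right inverse: the columns of [W] indexed by [D], divided by the edge lengths. *)
exists (\matrix_(i, q) (W i (enum_val q) / (hi (enum_val q) - lo (enum_val q)))).
apply/matrixP => p q; rewrite !mxE.
have rowE : lin (upd lo (enum_val p) (hi (enum_val p))) - lin lo =
    (hi (enum_val p) - lo (enum_val p)) *: v (enum_val p).
  rewrite -linB /lin (bigD1 (enum_val p)) //= /upd eqxx big1 ?addr0 // => j /negbTE ->.
  by rewrite subrr scale0r.
have VWpq : \sum_i v (enum_val p) ord0 i * W i (enum_val q) = (p == q)%:R.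
  transitivity ((1%:M : 'M[R]_r) (enum_val p) (enum_val q)).
    by rewrite -VW mxE; apply: eq_bigr => i _; rewrite mxE.
  by rewrite mxE (inj_eq enum_val_inj).
transitivity ((hi (enum_val p) - lo (enum_val p)) / (hi (enum_val q) - lo (enum_val q))
              * \sum_i v (enum_val p) ord0 i * W i (enum_val q)).
  by rewrite mulr_sumr; apply: eq_bigr => i _; rewrite mxE rowE !mxE; ring.
rewrite VWpq; case: eqP => [->|_]; last by rewrite mulr0.
by rewrite divff ?mulr1 //; apply: ltD; apply: enum_valP.
Qed.

(* [Some b] fixes a coordinate at [b]; [None] lets it range over [0, 1]. *)
Definition face (e : {ffun 'I_r -> option bool}) : set 'rV[R]_d :=
  natbox (fun i => e i == Some true) (fun i => e i != Some false).

Lemma face_le (e : {ffun 'I_r -> option bool}) i :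
  ((e i == Some true) <= (e i != Some false))%N.
Proof. by case: (e i) => [[]|]. Qed.

Lemma face_inj : injective face.
Proof.
move=> e e' /box_inj[i|i|lo hi].
- by rewrite ler_nat face_le.
- by rewrite ler_nat face_le.
apply/ffunP => i; have := congr1 (@^~ i) lo; have := congr1 (@^~ i) hi.
move=> /eqP; rewrite eqr_nat => /eqP h /eqP; rewrite eqr_nat => /eqP; move: h.
by case: (e i) => [[]|]; case: (e' i) => [[]|].
Qed.

Definition free_dirs (e : {ffun 'I_r -> option bool}) : {set 'I_r} :=
  [set i | e i == None]%SET.

Lemma pdim_face e : pdim (face e) = #|free_dirs e|.
Proof.
rewrite pdim_box => [|i]; last by rewrite ler_nat face_le.
by apply: eq_card => i; rewrite !inE ltr_nat; case: (e i) => [[]|].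
Qed.

Lemma phi_face e : phi (face e) = cubeval (free_dirs e).
Proof.
rewrite phi_natbox => [|i]; last exact: face_le.
congr boxval; apply/funext => i; rewrite /indic inE.
by case: (e i) => [[]|].
Qed.

Lemma dotv_lin (a : 'rV[R]_d) l : dotv a (lin l) = \sum_i l i * dotv a (v i).
Proof.
rewrite /dotv /lin; under eq_bigr => j _ do rewrite summxE mulr_sumr.
rewrite exchange_big /=; apply: eq_bigr => i _; rewrite mulr_sumr.
by apply: eq_bigr => j _; rewrite mxE mulrCA.
Qed.

Lemma parallelepiped_natbox (K : {set 'I_r}) :
  parallelepiped v K 1 = natbox (fun=> 0%N) (indic K).
Proof.
apply/seteqP; split => _ [l [hl ->]].
  exists (fun i => if i \in K then l i else 0); split => [i|].
    by rewrite /indic; case: ifP => [/hl|_] //=; rewrite lexx.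
  rewrite /lin big_mkcond /=; apply: eq_bigr => i _.
  by case: ifP; rewrite ?scale0r.
exists l; split => [i iK|]; first by have := hl i; rewrite /indic iK.
rewrite /lin [RHS]big_mkcond /=; apply: eq_bigr => i _.
have := hl i; rewrite /indic; case: ifP => // _ /le_anti <-.
by rewrite scale0r.
Qed.

(** The face maximizing a functional with value [c i] on [v i]: a positive value forces coordinate
    1, a negative one 0, and zero leaves the coordinate free. *)
Definition face_dir (K : {set 'I_r}) c : {ffun 'I_r -> option bool} :=
  [ffun i => if i \in K then
               if 0 < c i then Some true else if c i < 0 then Some false else None
             else Some false].

Lemma maximizers_face (K : {set 'I_r}) (a : 'rV[R]_d) :
  [set x | parallelepiped v K 1 x /\
           forall y, parallelepiped v K 1 y -> dotv a y <= dotv a x] =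
  face (face_dir K (fun i => dotv a (v i))).
Proof.
rewrite parallelepiped_natbox.
apply/seteqP; split => [_ [[l [hl ->]] lmax]|_ [l [hl ->]]].
  exists l; split => // i.
  (* Moving only coordinate [i] to [t] cannot increase the functional; [t = 0] and [t = 1] suffice
     below. *)
  have lt t : 0 <= t <= (i \in K)%:R -> (t - l i) * dotv a (v i) <= 0.
    move=> ht; have /lmax : natbox (fun=> 0%N) (indic K) (lin (upd l i t)).
      by apply/boxE => j; rewrite /upd; case: eqP => [->|_] //; apply: hl.
    rewrite -subr_le0 !dotv_lin -sumrB (bigD1 i) //= big1 => [|j /negbTE ne].
      by rewrite addr0 /upd eqxx mulrBl.
    by rewrite /upd ne subrr.
  have /andP[l0] := hl i; rewrite ffunE; rewrite /indic in lt *; case: ifP lt => iK lt l1.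
    have := lt 0; have := lt 1; rewrite !lexx !ler01 => /(_ isT) h1 /(_ isT) h0.
    case: ltgtP => [c0|c0|_] /=.
    + rewrite l1 andbT; move: h1; rewrite pmulr_lle0 // subr_le0 //.
    + rewrite l0 /=; move: h0; rewrite nmulr_lle0 // sub0r oppr_ge0 //.
    + by rewrite l0 l1.
  by rewrite l0 l1.
split.
  exists l; split => // i; have := hl i; rewrite ffunE /indic; case: ifP => // _.
  by case: ltgtP => _ //=; lra.
move=> _ [l' [hl' ->]]; rewrite !dotv_lin; apply: ler_sum => i _.
have := hl i; have := hl' i; rewrite ffunE /indic; case: ifP => _.
  case: ltgtP => [c0|c0|<-] /=.
  + by move=> /andP[_ h] /le_anti <-; rewrite ler_pM2r.
  + by move=> /andP[h _] /le_anti <-; rewrite ler_nM2r.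
  + by rewrite !mulr0.
by move=> /le_anti <- /le_anti <-.
Qed.

(** By independence every sign pattern on the [v i] is realized by a functional, hence every
    candidate face occurs. *)
Lemma dotv_surj c : exists a : 'rV[R]_d, forall i, dotv a (v i) = c i.
Proof.
have /row_freeP[W VW] := hvfree.
exists (W *m \col_i c i)^T => i.
transitivity ((\matrix_(i < r) v i *m (W *m \col_i c i)) i ord0).
  by rewrite mxE; apply: eq_bigr => j _; rewrite !mxE mulrC.
by rewrite mulmxA VW mul1mx mxE.
Qed.

Definition face_of (K : {set 'I_r}) : pred {ffun 'I_r -> option bool} :=
  fun e => [forall i, (i \in K) || (e i == Some false)].

Lemma nonempty_facesE (K : {set 'I_r}) :
  nonempty_faces (parallelepiped v K 1) = face @` [set` face_of K].
Proof.
apply/seteqP; split => [_ [_ [a ->]]|_ [e eK <-]].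
  rewrite maximizers_face; eexists; last by [].
  by apply/forallP => i; rewrite ffunE; case: ifP.
split.
  exists (lin (fun i => (e i == Some true)%:R)); apply/boxE => i.
  by rewrite lexx ler_nat face_le.
have [a aE] := dotv_surj (fun i => (e i == Some true)%:R - (e i == Some false)%:R).
exists a; rewrite maximizers_face; congr face.
apply/ffunP => i; rewrite ffunE aE; have /forallP/(_ i) := eK.
case: ifP => _ /=; last by move/eqP.
case: (e i) => [[]|] /= _; rewrite ?subr0 ?sub0r ?ltr01 ?ltrN10 ?ltxx //.
by rewrite ltNge lerN10.
Qed.

(** * Relative interiors and comparison of coefficients *)

(** Faces with free directions [J] all have value [cubeval J]. A fixed direction in [K] has two
    ends, each with sign -1, hence -2; one outside [K] has the single end 0; a free one must lie in
    [K]. *)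
Lemma bvalE (K : {set 'I_r}) :
  bval phi v K = \sum_J cubeval J *~
    \prod_i (if i \in J then (i \in K)%:R else if i \in K then -2 else 1).
Proof.
have pdimP : pdim (parallelepiped v K 1) = #|K|.
  rewrite parallelepiped_natbox pdim_box => [|i]; last by rewrite ler_nat.
  by apply: eq_card => i; rewrite !inE ltr_nat /indic lt0b.
rewrite /bval /val_relint nonempty_facesE pdimP.
rewrite fsbig_image; last by move=> e e' _ _; apply: face_inj.
rewrite -(@bigfs _ _ _ _ (index_enum _)) ?index_enum_uniq //; last first.
  by move=> e _; rewrite mem_index_enum.
(* The product of the [s e i] is the codimension sign if [e] encodes a face, and 0 otherwise. *)
pose s (e : {ffun 'I_r -> option bool}) i : int :=
  if i \in K then (if e i == None then 1 else -1) else (e i == Some false)%:R.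
transitivity (\sum_(e : {ffun 'I_r -> option bool}) cubeval (free_dirs e) *~ \prod_i s e i).
  rewrite big_mkcond /=; apply: eq_bigr => e _; case: ifP => [/forallP eK|].
    rewrite phi_face pdim_face; congr (_ *~ _).
    have feK : free_dirs e \subset K.
      by apply/fintype.subsetP => i; rewrite inE => /eqP ei; have := eK i; rewrite ei orbF.
    rewrite -cardsDS // -prodr_const big_mkcond /=.
    apply: eq_bigr => i _; rewrite /s !inE; have := eK i.
    by case: (i \in K) => /=; rewrite ?andbT ?andbF; case: eqP => // ->.
  move/negbT; rewrite negb_forall => /existsP[i]; rewrite negb_or => /andP[iK ei].
  by rewrite (bigD1 i) //= /s (negbTE iK) (negbTE ei) mul0r mulr0z.
(* The extra delta forces [J = free_dirs e], so that [J] and [e] can be summed independently. *)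
pose F (J : {set 'I_r}) i (c : option bool) : int := ((i \in J) == (c == None))%:R *
  (if i \in K then (if c == None then 1 else -1) else (c == Some false)%:R).
have FE (e : {ffun 'I_r -> option bool}) J :
    \prod_i F J i (e i) = if J == free_dirs e then \prod_i s e i else 0.
  case: eqP => [->|neJ].
    by apply: eq_bigr => i _; rewrite /F inE eqxx mul1r.
  have [i iJ] : exists i, (i \in J) != (i \in free_dirs e).
    apply/existsP; rewrite -negb_forall; apply/negP => /forallP h.
    by apply: neJ; apply/setP => i; apply/eqP.
  by rewrite (bigD1 i) //= /F; move: iJ; rewrite inE => /negbTE ->; rewrite !mul0r.
transitivity (\sum_(e : {ffun 'I_r -> option bool}) \sum_J cubeval J *~ \prod_i F J i (e i)).
  apply: eq_bigr => e _; rewrite (bigD1 (free_dirs e)) //= FE eqxx.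
  by rewrite [X in _ + X]big1 ?addr0 // => J /negbTE ne; rewrite FE ne.
rewrite exchange_big /=; apply: eq_bigr => J _; rewrite -mulrz_sumr; congr (_ *~ _).
rewrite -(bigA_distr_bigA (fun i (o : option bool) => F J i o)) /=; apply: eq_bigr => i _.
rewrite (bigD1 None) //= (bigD1 (Some true)) //= (bigD1 (Some false)) //= big1 => [|[[]|]] //.
by rewrite /F; case: (i \in J); case: (i \in K).
Qed.

Lemma val_halfopen_bval (I : {set 'I_r}) (n : nat) :
  val_halfopen phi v I n =
  \sum_K bval phi v K *~ (n%:R ^+ #|I :|: K| * n.+1%:R ^+ (r - #|I :|: K|)).
Proof.
pose w (K : {set 'I_r}) i : int := if (i \in I) || (i \in K) then n%:R else n.+1%:R.
have wE (K : {set 'I_r}) :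
    n%:R ^+ #|I :|: K| * n.+1%:R ^+ (r - #|I :|: K|) = \prod_i w K i.
  rewrite (bigID (fun i => i \in I :|: K)) /=; congr (_ * _).
    rewrite -prodr_const; apply: eq_bigr => i; rewrite /w inE => -> //.
  rewrite -[r in (r - _)%N]card_ord -(finset.setCK (I :|: K)) -cardsCs -prodr_const.
  by apply: eq_big => [i|i]; rewrite /w !inE ?negbK // => /negbTE ->.
under eq_bigr => K _ do rewrite wE bvalE mulrz_suml.
rewrite val_halfopenE exchange_big /=; apply: eq_bigr => J _.
under [RHS]eq_bigr => K _ do rewrite -mulrzA -big_split /=.
rewrite -mulrz_sumr; congr (_ *~ _).
(* Contributions of [i] in [K] and [i] outside [K]. They add up to [n] on [J]; off [J] to -2n + n =
   -n in [I] and to -2n + (n+1) = 1 - n outside [I], as in [val_halfopenE]. *)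
pose F i : int := (if i \in J then 1 else -2) * n%:R.
pose F' i : int := (if i \in J then 0 else 1) * (if i \in I then n%:R else n.+1%:R).
transitivity (\prod_i (F i + F' i)).
  apply: eq_bigr => i _; rewrite /F /F' -natr1.
  by case: (i \in I); case: (i \in J) => /=; ring.
rewrite bigA_distr; apply: eq_bigr => K _; apply: eq_bigr => i _.
rewrite /F /F' /w.
by case: (i \in I); case: (i \in J); case: (i \in K); rewrite ?mul0r ?mul1r.
Qed.

End Boxes.

Theorem theorem4p7 (R : realType) (d r : nat) (G : zmodType)
    (phi : set 'rV[R]_d -> G) (v : 'I_r -> 'rV[R]_d) (I : {set 'I_r})
    (hphi : Zd_valuation phi)
    (hvZ : forall i, lattice_point (v i))
    (hvfree : row_free (\matrix_(i < r) v i)) :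
  (fun n : nat => val_halfopen phi v I n)
  = ps_divp (fun n : nat => \sum_(K : {set 'I_r})
               bval phi v K *~ (eulerA #|I :|: K|.+1 r.+1)`_n)
            ((1 - 'X) ^+ r.+1).
Proof.
apply/funext => n; rewrite (val_halfopen_bval _ _ _ _ hvfree hvZ _ _ hphi) /ps_divp.
under [RHS]eq_bigr => k _ do rewrite mulrz_suml.
rewrite [RHS]exchange_big /=; apply: eq_bigr => K _.
under [RHS]eq_bigr => k _ do rewrite -mulrzA.
rewrite -mulrz_sumr; congr (_ *~ _).
have leIKr : (#|I :|: K| <= r)%N by rewrite -[leqRHS]card_ord max_card.
(* The index |I u K| + 1 corresponds to the last letter r - |I u K|, counted from 0. *)
have lta : (r - #|I :|: K| < r.+1)%N by rewrite ltnS leq_subr.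
rewrite (eulerAE _ _ (Ordinal lta)) ?subnK // eulerian_quotient /=.
by rewrite subKn.
Qed.
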